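(* Let $(M,g)$ be a complete Riemannian manifold, let $A\subseteq M$ be a totally convex set, let $\varphi:\mathbb{R}\times\mathbb{R}\to\mathbb{R}$ be non-decreasing, and let $f:A\to\mathbb{R}$ be a function. Then $f$ is geodesic $\varphi$-convex if and only if its $\varphi$-epigraph $E_\varphi(f)$ is a geodesic $\varphi$-convex set.
   Context: For $x,y\in M$, $\alpha_{xy}:[0,1]\to M$ denotes a geodesic arc with $\alpha_{xy}(0)=x$ and $\alpha_{xy}(1)=y$. A non-empty subset $A\subseteq M$ is totally convex if it contains every geodesic $\alpha_{xy}$ of $M$ whose end points $x,y$ belong to $A$. A function $f:A\to\mathbb{R}$ on a totally convex set $A$ is geodesic $\varphi$-convex if $f(\alpha_{xy}(t))\le f(x)+t\,\varphi(f(y),f(x))$ for all $x,y\in A$, every geodesic arc $\alpha_{xy}$ from $x$ to $y$, and all $t\in[0,1]$. The function $\varphi$ is non-decreasing if $x_1\le x_2$ and $y_1\le y_2$ imply $\varphi(x_1,y_1)\le\varphi(x_2,y_2)$ for $x_1,x_2,y_1,y_2\in\mathbb{R}$. A set $B\subseteq M\times\mathbb{R}$ is geodesic $\varphi$-convex if for any two points $(x,a),(y,b)\in B$ and every geodesic arc $\alpha_{xy}$ from $x$ to $y$, one has $(\alpha_{xy}(t),\,a+t\,\varphi(b,a))\in B$ for all $0\le t\le 1$. The $\varphi$-epigraph of $f:A\to\mathbb{R}$ is $E_\varphi(f)=\{(x,a)\in A\times\mathbb{R}: f(x)\le a\}$. *)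

(* Defs.v *)
From HB Require Import structures.
From mathcomp Require Import all_boot all_order all_algebra.
From mathcomp Require Import all_classical all_reals all_analysis.
Set Implicit Arguments.
Unset Strict Implicit.
Unset Printing Implicit Defensive.
Import Order.TTheory GRing.Theory Num.Theory.
Import numFieldNormedType.Exports.
Local Open Scope classical_set_scope.
Local Open Scope ring_scope.

(** * Smooth functions on open subsets of [R^n] *)

Definition partial (R : realType) (n : nat) (i : 'I_n)
  (f : 'rV[R]_n -> R) (x : 'rV[R]_n) : R := 'D_('e_i) f x.

(* Meaningful for open [U] only: membership in [C^k(U)] is then independent of
   the values of [f] outside [U]. *)
Fixpoint Ck_on (R : realType) (n : nat) (k : nat) (U : set 'rV[R]_n)
    (f : 'rV[R]_n -> R) : Prop :=
  (forall x, U x -> {for x, continuous f}) /\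
  if k is k'.+1 then
    forall i : 'I_n,
      (forall x, U x -> derivable f x 'e_i) /\ Ck_on k' U (partial i f)
  else True.

Definition smooth_on (R : realType) (n : nat) (U : set 'rV[R]_n)
  (f : 'rV[R]_n -> R) : Prop := forall k, Ck_on k U f.

(** * Smooth manifolds *)

(* [chart_map] and [chart_inv] are total functions; they are only relevant on
   [chart_dom] and on its image, respectively. *)
Record chart (R : realType) (n : nat) (M : topologicalType) := Chart {
  chart_dom : set M;
  chart_map : M -> 'rV[R]_n;
  chart_inv : 'rV[R]_n -> M;
  chart_dom_open : open chart_dom;
  chart_img_open : open (chart_map @` chart_dom);
  chart_mapK : forall p, chart_dom p -> chart_inv (chart_map p) = p;
  chart_map_cts : forall p, chart_dom p -> {for p, continuous chart_map};
  chart_inv_cts : forall x, (chart_map @` chart_dom) x ->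
    {for x, continuous chart_inv} }.

Definition chart_img (R : realType) (n : nat) (M : topologicalType)
  (c : chart R n M) : set 'rV[R]_n := chart_map c @` chart_dom c.

Definition transition_dom (R : realType) (n : nat) (M : topologicalType)
    (c d : chart R n M) : set 'rV[R]_n :=
  chart_map c @` (chart_dom c `&` chart_dom d).

Definition transition (R : realType) (n : nat) (M : topologicalType)
    (c d : chart R n M) : 'rV[R]_n -> 'rV[R]_n :=
  chart_map d \o chart_inv c.

(* The atlas is not required to be maximal. *)
Record manifold (R : realType) (n : nat) := Manifold {
  carrier :> topologicalType;
  carrier_hausdorff : hausdorff_space carrier;
  carrier_second_countable : @second_countable carrier;
  atlas : set (chart R n carrier);
  atlas_cover : forall p : carrier, exists2 c, atlas c & chart_dom c p;
  atlas_smooth : forall c d, atlas c -> atlas d -> forall k : 'I_n,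
    smooth_on (transition_dom c d) (fun x => transition c d x 0 k) }.

(** * Riemannian metrics and geodesics *)

(* A Riemannian metric is given by its Gram matrices [(g_ij)] in the charts of
   the atlas.  With row vectors, ['J tau x] has the [i]-th partial derivative of
   [tau] as [i]-th row, so [metric_change] is the transformation law of
   covariant 2-tensors. *)
Record metric (R : realType) (n : nat) (M : manifold R n) := Metric {
  gram :> chart R n M -> 'rV[R]_n -> 'M[R]_n;
  gram_smooth : forall c, atlas c -> forall i j : 'I_n,
    smooth_on (chart_img c) (fun x => gram c x i j);
  gram_sym : forall c, atlas c -> forall x, chart_img c x ->
    (gram c x)^T = gram c x;
  gram_posdef : forall c, atlas c -> forall x, chart_img c x ->
    forall v : 'rV[R]_n, v != 0 -> 0 < (v *m gram c x *m v^T) 0 0;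
  metric_change : forall c d, atlas c -> atlas d ->
    forall x, transition_dom c d x ->
    gram c x = 'J (transition c d) x *m gram d (transition c d x)
               *m ('J (transition c d) x)^T }.

(* The Christoffel symbol [Gamma^k_ij] of the Levi-Civita connection in the
   chart [c]. *)
Definition christoffel (R : realType) (n : nat) (M : manifold R n)
    (g : metric M) (c : chart R n M) (x : 'rV[R]_n) (k i j : 'I_n) : R :=
  2^-1 * \sum_(l < n) invmx (g c x) k l *
    (partial i (fun y => g c y j l) x + partial j (fun y => g c y i l) x
     - partial l (fun y => g c y i j) x).

(* [gamma] solves the geodesic equation at every time of the open set [D].
   Constant curves are geodesics. *)
Definition geodesic_on (R : realType) (n : nat) (M : manifold R n)
    (g : metric M) (D : set R) (gamma : R -> M) : Prop :=
  forall t, D t -> {for t, continuous gamma} /\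
  forall c, atlas c -> chart_dom c (gamma t) ->
  forall k : 'I_n,
    let x (i : 'I_n) : R -> R := fun s => chart_map c (gamma s) 0 i in
    [/\ \forall s \near t, derivable (x k) s 1,
        derivable (derive1 (x k)) t 1 &
        derive1 (derive1 (x k)) t + \sum_(i < n) \sum_(j < n)
          christoffel g c (chart_map c (gamma t)) k i j
            * derive1 (x i) t * derive1 (x j) t = 0].

Definition complete (R : realType) (n : nat) (M : manifold R n)
    (g : metric M) : Prop :=
  forall (a b : R) (gamma : R -> M), a < b ->
  geodesic_on g [set` `]a, b[] gamma ->
  exists2 delta : R -> M, geodesic_on g setT delta &
    forall t, a < t < b -> delta t = gamma t.

(* Only the restriction of [alpha] to [[0, 1]] matters; a geodesic on the closed
   interval is one that is a geodesic on a neighbourhood of it. *)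
Definition geodesic_arc (R : realType) (n : nat) (M : manifold R n)
    (g : metric M) (x y : M) (alpha : R -> M) : Prop :=
  [/\ alpha 0 = x, alpha 1 = y &
    exists (e : R) (gamma : R -> M),
      [/\ 0 < e, geodesic_on g [set` `]- e, 1 + e[] gamma &
          forall t, 0 <= t <= 1 -> alpha t = gamma t]].

(** * Geodesic phi-convexity *)

Definition totally_convex (R : realType) (n : nat) (M : manifold R n)
    (g : metric M) (A : set M) : Prop :=
  A !=set0 /\
  forall x y alpha, A x -> A y -> geodesic_arc g x y alpha ->
  forall t, 0 <= t <= 1 -> A (alpha t).

Definition nondecreasing2 (R : realType) (phi : R -> R -> R) : Prop :=
  forall x1 x2 y1 y2, x1 <= x2 -> y1 <= y2 -> phi x1 y1 <= phi x2 y2.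

(* A function on [A] is represented by a total function of which only the
   values on [A] are used. *)
Definition geodesic_phi_convex (R : realType) (n : nat) (M : manifold R n)
    (g : metric M) (phi : R -> R -> R) (A : set M) (f : M -> R) : Prop :=
  forall x y alpha, A x -> A y -> geodesic_arc g x y alpha ->
  forall t, 0 <= t <= 1 -> f (alpha t) <= f x + t * phi (f y) (f x).

Definition geodesic_phi_convex_set (R : realType) (n : nat) (M : manifold R n)
    (g : metric M) (phi : R -> R -> R) (B : set (M * R)) : Prop :=
  forall x a y b alpha, B (x, a) -> B (y, b) -> geodesic_arc g x y alpha ->
  forall t, 0 <= t <= 1 -> B (alpha t, a + t * phi b a).

Definition epigraph (R : realType) (M : Type) (A : set M) (f : M -> R) :
  set (M * R) := [set p | A p.1 /\ f p.1 <= p.2].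

(* Main.v *)
Require Import Defs.
From mathcomp Require Import all_boot all_order all_algebra.
From mathcomp Require Import all_classical all_reals all_analysis.

(** Monotonicity of [phi] makes the chord bound [a + t * phi b a]
    nondecreasing in both heights [a] and [b] (because [0 <= t]), so the
    inequality at the graph points [(x, f x)] and [(y, f y)] gives it at all
    points above them.  Conversely, the graph lies in the epigraph, and
    membership of the chord through two graph points is the convexity
    inequality.  Total convexity keeps the arc inside [A]. *)

Theorem theorem5p1 (R : realType) (n : nat) (M : manifold R n) (g : metric M)
  (hg : complete g) (A : set M) (hA : totally_convex g A)
  (phi : R -> R -> R) (hphi : nondecreasing2 phi) (f : M -> R) :
  geodesic_phi_convex g phi A f <->
  geodesic_phi_convex_set g phi (epigraph A f).
Proof.
case: hA => _ arcA; split.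
- move=> cvx_f x a y b alpha [/= Ax fxa] [/= Ay fyb] arc t t01.
  split => /=; first exact: arcA Ax Ay arc t t01.
  have /andP[t0 _] := t01.
  apply: Order.POrderTheory.le_trans (cvx_f _ _ _ Ax Ay arc t t01) _.
  apply: Num.Theory.lerD => //.
  by apply: Num.Theory.ler_wpM2l => //; exact: hphi.
- move=> cvx_epi x y alpha Ax Ay arc t t01.
  have epi_graph z : A z -> epigraph A f (z, f z) by split=> /=.
  by case: (cvx_epi _ _ _ _ _ (epi_graph x Ax) (epi_graph y Ay) arc t t01).
Qed.
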